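(* In the network slicing model described in the context, let $v\in\mathcal V$. The BTD gain of SCPF over SS for slice $v$, $G_v^{SS}=\mathbb{E}^v[1/R^{v,SS}]\,/\,\mathbb{E}^v[1/R^{v}]$, is $$G_v^{SS}=\frac{\rho^v\|\tilde{\boldsymbol\rho}^v\|_{\boldsymbol\Delta^v}^2+\langle\boldsymbol\delta^v,\tilde{\boldsymbol\rho}^v\rangle}{s^v\langle\boldsymbol\delta^v,\tilde{\boldsymbol\rho}^v\rangle-s^v\left(1-(\rho^v+1)e^{-\rho^v}\right)\|\tilde{\boldsymbol\rho}^v\|_{\boldsymbol\Delta^v}^2+(\rho^v+1)\langle\tilde{\boldsymbol g}',\tilde{\boldsymbol\rho}^v\rangle_{\boldsymbol\Delta^v}}.$$ Moreover, for fixed relative loads $(\tilde{\boldsymbol\rho}^w:w\in\mathcal V)$: (i) when slice $v$ has a light load, i.e. $\rho^v\to0$ (the other overall loads being fixed), the gain is greater than 1 and given by $$G_v^{SS,L}=\frac{\langle\boldsymbol\delta^v,\tilde{\boldsymbol\rho}^v\rangle}{s^v\langle\boldsymbol\delta^v,\tilde{\boldsymbol\rho}^v\rangle+\langle\tilde{\boldsymbol g}',\tilde{\boldsymbol\rho}^v\rangle_{\boldsymbol\Delta^v}}>1,$$ where $\tilde{\boldsymbol g}'$ is evaluated at $\rho^v=0$, i.e. $\tilde g'_b=\sum_{w\ne v}s^w(1-e^{-\rho^w})\tilde\rho_b^w$; (ii) $G_v^{SS}$ is a nonincreasing function of $\rho^v$ (the other overall loads being fixed); (iii) if all slices have high overall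 loads, i.e. $\rho^w\to\infty$ for all $w\in\mathcal V$, the gain is given by $$G_v^{SS,H}=\frac{\|\tilde{\boldsymbol\rho}^v\|_{\boldsymbol\Delta^v}^2}{\langle\tilde{\boldsymbol g},\tilde{\boldsymbol\rho}^v\rangle_{\boldsymbol\Delta^v}}.$$
   Context: Model. $\mathcal B$ (base stations) and $\mathcal V$ (slices) are finite nonempty sets. Each slice $v$ has a share $s^v>0$, with $\sum_{v\in\mathcal V}s^v=1$. The number $N_b^v$ of customers of slice $v$ at base station $b$ is Poisson with mean $\rho_b^v\ge 0$, and the variables $(N_b^v)_{b,v}$ are mutually independent. Put $N^v=\sum_b N_b^v$, $\rho^v=\sum_b\rho_b^v>0$ (overall load). Each customer $u$ of slice $v$ at base station $b$ has a peak rate $c_u>0$; the peak rates are independent of each other and of the counts, and $c_u$ is distributed as a random variable $C_b^v$ with $\delta_b^v:=\mathbb E[1/C_b^v]\in(0,\infty)$. Rates. When the counts are $n_b^v$ and $n^v=\sum_b n_b^v$, a customer $u$ of slice $v$ at base station $b$ receives rate $r_u^{SS}=\frac{s^v}{n_b^v}c_u$ under Static Slicing (SS), and $r_u^{SCPF}=\frac{s^v/n^v}{\sum_{w\in\mathcal V:\,n^w>0}n_b^{w}s^{w}/n^{w}}c_u$ under Share Constrained Proportionally Fair (SCPF) sharing. Mean bit transmission delay (BTD) of a typical customer (Palm expectation): $\mathbb E^v[1/R^v]=\frac1{\rho^v}\mathbb E\big[\sum_{b}\sum_{u\in\mathcal U_b^v}1/r_u^{SCPF}\big]$, where $\mathcal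 U_b^v$ is the set of the $N_b^v$ customers of slice $v$ at $b$; $\mathbb E^v[1/R^{v,SS}]$ is defined likewise with $r_u^{SS}$. Notation. $\tilde\rho_b^v=\rho_b^v/\rho^v$, $\tilde{\boldsymbol\rho}^v=(\tilde\rho_b^v)_b$; $\tilde{\boldsymbol g}=(\tilde g_b)_b$ with $\tilde g_b=\sum_{w\in\mathcal V}s^w\tilde\rho_b^w$; $\tilde{\boldsymbol g}'=(\tilde g_b')_b$ with $\tilde g_b'=\sum_{w\in\mathcal V}s^w(1-e^{-\rho^w})\tilde\rho_b^w$; $\boldsymbol\delta^v=(\delta_b^v)_b$, $\boldsymbol\Delta^v=\mathrm{diag}(\boldsymbol\delta^v)$. For a diagonal matrix $\boldsymbol M$, $\langle\boldsymbol x,\boldsymbol y\rangle_{\boldsymbol M}=\boldsymbol x^T\boldsymbol M\boldsymbol y$ and $\|\boldsymbol x\|_{\boldsymbol M}^2=\boldsymbol x^T\boldsymbol M\boldsymbol x$; $\langle\cdot,\cdot\rangle$ without subscript is the standard inner product.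
   Formalization: In (i), the strict inequality G_v^{SS,L} > 1 is stated only when there are at least two slices; with a single slice s^v = 1 and g̃' = 0 at ρ^v = 0, so G_v^{SS,L} = 1 and the claim ''> 1'' fails. *)

(* Defs.v *)
From HB Require Import structures.
From mathcomp Require Import all_boot all_order all_algebra.
From mathcomp Require Import all_classical all_reals all_analysis.

Set Implicit Arguments.
Unset Strict Implicit.
Unset Printing Implicit Defensive.

Import Order.TTheory GRing.Theory Num.Theory.
Import numFieldNormedType.Exports.

Local Open Scope classical_set_scope.
Local Open Scope ring_scope.

(* [inner_diag m x y] is x^T diag(m) y; [inner x y] is x^T y. *)
Definition inner (R : realType) (B : finType) (x y : B -> R) : R :=
  \sum_b x b * y b.

Definition inner_diag (R : realType) (B : finType) (m x y : B -> R) : R :=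
  \sum_b x b * m b * y b.

Definition sqnorm_diag (R : realType) (B : finType) (m x : B -> R) : R :=
  inner_diag m x x.

Section Loads.
Context (R : realType) (B V : finType).
Implicit Types rho : B -> V -> R.

Definition overall_load rho (w : V) : R := \sum_b rho b w.

Definition relative_load rho (w : V) (b : B) : R :=
  rho b w / overall_load rho w.

End Loads.

Section Rates.
Context (R : realType) (B V : finType) (s : V -> R).
Implicit Types n : B -> V -> nat.

Definition slice_count n (w : V) : nat := (\sum_b n b w)%N.

Definition rate_SS n (b : B) (v : V) (c : R) : R :=
  s v / (n b v)%:R * c.

Definition rate_SCPF n (b : B) (v : V) (c : R) : R :=
  (s v / (slice_count n v)%:R) /
  (\sum_(w | (0 < slice_count n w)%N)
     (n b w)%:R * s w / (slice_count n w)%:R) * c.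

End Rates.

(* Mutual independence of a family of set systems: the product rule holds for
   every finite subfamily. *)
Definition mutually_independent (R : realType) (d : measure_display)
    (T : measurableType d) (P : probability T R) (I : eqType)
    (G : I -> set_system T) : Prop :=
  forall (J : seq I) (A : I -> set T), uniq J ->
    (forall i, i \in J -> G i (A i)) ->
    P (\big[setI/setT]_(i <- J) A i) = (\prod_(i <- J) P (A i))%E.

(* Index [inl (b, w)] carries the sigma-algebra generated by the count N_b^w,
   index [inr (b, w, k)] the one generated by the k-th peak rate of slice w at
   base station b. *)
Definition generated_system (R : realType) (B V : finType)
    (d : measure_display) (T : measurableType d) (P : probability T R)
    (N : B -> V -> {RV P >-> nat}) (c : B -> V -> nat -> {RV P >-> R})
    (i : ((B * V) + (B * V * nat))%type) : set_system T :=
  match i with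
  | inl (b, w) => preimage_set_system setT (N b w) measurable
  | inr (b, w, k) => preimage_set_system setT (c b w k) measurable
  end.

(* The peak rates of slice w at b form an infinite sequence, of which the
   customers present are those of rank k < N_b^w.  The second argument of
   [poisson_prob] is a dummy; at rate 0 it is the Dirac mass at 0. *)
Record slicing_model (R : realType) (B V : finType) (d : measure_display)
    (T : measurableType d) (Q : probability T R)
    (C : B -> V -> {RV Q >-> R}) := SlicingModel {
  load : B -> V -> R;
  load_ge0 : forall b w, 0 <= load b w;
  overall_load_gt0 : forall w, 0 < overall_load load w;
  sample_disp : measure_display;
  sample_space : measurableType sample_disp;
  prob : probability sample_space R;
  count : B -> V -> {RV prob >-> nat};
  count_poisson : forall b w (A : set nat),
    distribution prob (count b w) A = poisson_prob (load b w) 0%N A;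
  peak : B -> V -> nat -> {RV prob >-> R};
  peak_gt0 : forall b w k x, 0 < peak b w k x;
  peak_distribution : forall b w k (A : set R), measurable A ->
    distribution prob (peak b w k) A = distribution Q (C b w) A;
  model_independent :
    mutually_independent prob (generated_system count peak)
}.

Section Gain.
Context (R : realType) (B V : finType) (s : V -> R) (d : measure_display)
  (T : measurableType d) (Q : probability T R) (C : B -> V -> {RV Q >-> R}).
Implicit Types m : slicing_model C.

Definition mean_inverse_peak (b : B) (w : V) : \bar R :=
  'E_Q[(fun x => (C b w x)^-1)%R]%E.

Definition delta (w : V) (b : B) : R := fine (mean_inverse_peak b w).

(* Mean bit transmission delay under the allocation [rate], which maps the
   counts, b, v and the peak rate of a customer to the rate of the customer. *)
Definition mean_BTD (rate : (B -> V -> nat) -> B -> V -> R -> R) m (v : V) :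
    \bar R :=
  (((overall_load (load m) v)^-1)%:E *
   'E_(prob m)[(fun x => \sum_b \sum_(k < count m b v x)
      (rate (fun b' w => count m b' w x) b v (peak m b v k x))^-1)%R])%E.

Definition BTD_gain m (v : V) : \bar R :=
  (mean_BTD (rate_SS s) m v / mean_BTD (rate_SCPF s) m v)%E.

End Gain.

Section Formulas.
Context (R : realType) (B V : finType) (s : V -> R).
Implicit Types (rt : V -> B -> R) (r : V -> R) (dl : V -> B -> R).

Definition g_tilde rt (b : B) : R := \sum_w s w * rt w b.

Definition g_tilde' r rt (b : B) : R :=
  \sum_w s w * (1 - expR (- r w)) * rt w b.

(* Below, [r] are the overall loads, [rt] the relative loads and [dl] the
   mean inverse peak rates. *)
Definition gain_formula r rt dl (v : V) : R :=
  (r v * sqnorm_diag (dl v) (rt v) + inner (dl v) (rt v)) /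
  (s v * inner (dl v) (rt v)
   - s v * (1 - (r v + 1) * expR (- r v)) * sqnorm_diag (dl v) (rt v)
   + (r v + 1) * inner_diag (dl v) (g_tilde' r rt) (rt v)).

Definition light_gain r rt dl (v : V) : R :=
  inner (dl v) (rt v) /
  (s v * inner (dl v) (rt v)
   + inner_diag (dl v) (g_tilde' (fun w => if w == v then 0 else r w) rt)
       (rt v)).

Definition heavy_gain rt dl (v : V) : R :=
  sqnorm_diag (dl v) (rt v) / inner_diag (dl v) (g_tilde rt) (rt v).

End Formulas.

(* Main.v *)
(** On the event that all counts equal n, the sum of inverse rates is a finite
combination of inverse peak rates independent of that event, so each mean delay
is a sum over b of delta_b times E[N_b G_b(N)], G_b being a function of the
counts alone.  These moments follow from the Mecke equation
E[N_i f(N)] = rho_i E[f(N + e_i)] of independent Poisson variables; for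
instance E[phi N_b / N^w] is rho_b times a constant, found by summing over b.
With a = |rt|^2_Delta, c = <delta, rt> and h >= 0 collecting the other slices,
the gain is (r a + c) / (s (r a + c) + (r + 1) h), which is nonincreasing in r
because a <= c. *)

Require Import Defs.
From HB Require Import structures.
From mathcomp Require Import all_boot all_order all_algebra.
From mathcomp Require Import all_classical all_reals all_analysis measurable_realfun.
From mathcomp Require Import ring.
Import Order.TTheory GRing.Theory Num.Theory.
Import numFieldNormedType.Exports.
Local Open Scope classical_set_scope.
Local Open Scope ring_scope.

Set Implicit Arguments.
Unset Strict Implicit.
Unset Printing Implicit Defensive.

(** * Measurability and integration along a discrete random variable *)

(** Inversion is continuous off 0, and on the closed singleton of 0 it is constant because
    [0^-1 = 0]. *)
Lemma measurable_invr (R : realType) : measurable_fun [set: R] (@GRing.inv R).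
Proof.
rewrite -(setUv [set 0 : R]); apply/measurable_funU => //.
  exact: measurableC.
split.
  apply: (@eq_measurable_fun _ _ R R _ (cst 0)) => [x|]; last exact: measurable_cst.
  by rewrite inE /= => ->; rewrite invr0.
apply: open_continuous_measurable_fun.
  by rewrite openC; exact: closed_eq.
by move=> x; rewrite inE /= => /eqP; exact: inv_continuous.
Qed.

Section discrete_partition.
Local Open Scope ereal_scope.
Context {d} {T : measurableType d} {R : realType} (K : countType) (X : T -> K).
Hypothesis mX : forall n, measurable (X @^-1` [set n]).

(** The fibres of [X] are indexed by [nat] through [pickle], the form that countable unions and
    series expect; a number coding no element of [K] gives the empty set. *)
Let F (i : nat) := [set x | pickle (X x) = i].

Let mF i : measurable (F i).
Proof.
have [[n en]|ne] := pselect (exists n, pickle (n : K) = i).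
  rewrite (_ : F i = X @^-1` [set n])//; apply/seteqP; split => x /=.
    by rewrite /F/= -en => /(pcan_inj pickleK).
  by rewrite /F/= => ->.
rewrite (_ : F i = set0)//; apply/seteqP; split => x //= Fx; apply: ne.
by exists (X x).
Qed.

Let UF : \bigcup_i F i = setT.
Proof. by apply/seteqP; split => // x _; exists (pickle (X x)). Qed.

(** Meant for sums whose number of terms is random: it suffices to treat each frozen value of
    [X]. *)
Lemma measurable_fun_partition {d'} {U : measurableType d'} (f : T -> U) :
  (forall n, measurable_fun (X @^-1` [set n]) f) -> measurable_fun setT f.
Proof.
move=> mf; rewrite -UF; apply/(measurable_fun_bigcup _ _).2 => // i.
have [[n en]|ne] := pselect (exists n, pickle (n : K) = i).
  rewrite (_ : F i = X @^-1` [set n])//; apply/seteqP; split => x /=.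
    by rewrite /F/= -en => /(pcan_inj pickleK).
  by rewrite /F/= => ->.
rewrite (_ : F i = set0)//; first exact: measurable_fun_set0.
by apply/seteqP; split => x //= Fx; apply: ne; exists (X x).
Qed.

Lemma measurable_fun_discrete {d'} {U : measurableType d'} (g : K -> U) :
  measurable_fun setT (g \o X).
Proof.
apply: measurable_fun_partition => n; apply: (eq_measurable_fun (cst (g n))).
  by move=> x; rewrite inE /= => ->.
exact: measurable_cst.
Qed.

(** Countable additivity over the fibres, with the series over codes turned into an unordered sum
    over [K]. *)
Lemma ge0_integral_partition (mu : {measure set T -> \bar R}) (f : T -> \bar R) :
  measurable_fun setT f -> (forall x, 0 <= f x) ->
  \int[mu]_x f x = \esum_(n in [set: K]) \int[mu]_(x in X @^-1` [set n]) f x.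
Proof.
move=> mf f0; rewrite -UF ge0_integral_bigcup ?UF//; last first.
  by apply/trivIsetP => i j _ _ ij; apply/seteqP; split => x // -[/= ei ej];
  move: ij; rewrite -(ei : pickle (X x) = i) -(ej : pickle (X x) = j) eqxx.
rewrite nneseries_esumT; last by move=> i; exact: integral_ge0.
rewrite (esumID (range (@pickle K))); last by move=> i _; exact: integral_ge0.
(* Numbers outside the range of [pickle] index empty fibres and contribute 0. *)
rewrite [X in _ + X]esum1 ?adde0; last first.
  move=> i [_ /= ni]; rewrite (_ : F i = set0) ?integral_set0//.
  by apply/seteqP; split => x //= Fx; apply: ni; exists (X x).
rewrite setTI esum_image; last by move=> n m _ _; exact: (pcan_inj pickleK).
apply: eq_esum => n _; congr (integral mu _ f); apply/seteqP; split => x /=.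
  by rewrite /F/= => /(pcan_inj pickleK).
by rewrite /F/= => ->.
Qed.

End discrete_partition.

(** Under [P] restricted to [A], the image measure of [c] is [P A] times the law of [c]; the claim
    is a change of variables on both sides. *)
Lemma ge0_integral_indep (R : realType) d (T : measurableType d)
    (P : probability T R) (A : set T) d' (U : measurableType d') (c : {RV P >-> U})
    (f : U -> \bar R) :
  measurable A ->
  (forall S, measurable S -> P (c @^-1` S `&` A) = (P A * P (c @^-1` S))%E) ->
  measurable_fun setT f -> (forall x, (0 <= f x)%E) ->
  (\int[P]_(x in A) f (c x) = P A * \int[P]_x f (c x))%E.
Proof.
move=> mA indep mf f0.
have mfc : measurable_fun setT (f \o c) by exact: measurableT_comp.
rewrite (eq_measure_integral (mrestr P mA)) => [|S mS SA]; last first.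
  by transitivity (P (S `&` A)); first rewrite setIidl.
(* The restricted measure gives no mass to the complement of [A], so the domain can be enlarged to
   the whole space, as the image measure requires. *)
have -> : (\int[mrestr P mA]_(x in A) f (c x) = \int[mrestr P mA]_x f (c x))%E.
  rewrite -(setUv A) ge0_integral_setU//=.
  - rewrite [X in (_ = _ + X)%E]null_set_integral ?adde0//.
    + exact: measurableC.
    + exact: measurable_funTS.
    + by rewrite -(measure0 P) -(setICl A).
  - exact: measurableC.
  - by rewrite setUv.
  - by apply/disj_setPS; rewrite setICr.
rewrite -[LHS](@ge0_integral_pushforward _ _ _ _ _ c _ (mrestr P mA) setT f)//.
have PA : (fine (P A))%:E = P A by rewrite fineK// fin_num_measure.
have PA0 : (0 <= fine (P A))%R by rewrite fine_ge0.
rewrite (eq_measure_integral (mscale (NngNum PA0) (distribution P c))).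
  by rewrite ge0_integral_mscale// ge0_integral_distribution// -[in RHS]PA.
by move=> S mS _; rewrite -[RHS]/((fine (P A))%:E * P (c @^-1` S))%E PA -indep.
Qed.

(** * Poisson weights and the Mecke equation *)

Definition add_at (I : finType) (i : I) (n : {ffun I -> nat}) : {ffun I -> nat} :=
  [ffun j => (n j + (j == i))%N].

Lemma add_at_inj (I : finType) (i : I) : injective (add_at i).
Proof.
by move=> n m /ffunP nm; apply/ffunP => j; have := nm j; rewrite !ffunE => /addIn.
Qed.

(** Joint mass function of independent Poisson variables of means [rho i]; a zero mean gives the
    Dirac mass at 0, because [0 ^+ 0 = 1]. *)
Definition poisson_weight (R : realType) (I : finType) (rho : I -> R)
    (n : {ffun I -> nat}) : R :=
  \prod_i (rho i ^+ n i / (n i)`!%:R * expR (- rho i)).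

Lemma poisson_weight_ge0 (R : realType) (I : finType) (rho : I -> R) n :
  (forall i, 0 <= rho i) -> 0 <= poisson_weight rho n.
Proof.
move=> rho0; apply: prodr_ge0 => i _.
by rewrite mulr_ge0 ?expR_ge0// divr_ge0 ?exprn_ge0.
Qed.

(** The Mecke equation at a single point: only the factor at [i] changes, and there (k+1) rho^(k+1)
    / (k+1)! = rho rho^k / k!. *)
Lemma poisson_weight_add_at (R : realType) (I : finType) (rho : I -> R) i n :
  (add_at i n i)%:R * poisson_weight rho (add_at i n) =
  rho i * poisson_weight rho n.
Proof.
rewrite /poisson_weight (bigD1 i)//= [in RHS](bigD1 i)//=.
rewrite (eq_bigr (fun j => rho j ^+ n j / (n j)`!%:R * expR (- rho j))); last first.
  by move=> j /negbTE ji; rewrite /add_at ffunE ji addn0.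
rewrite /add_at ffunE eqxx addn1 factS natrM exprS.
have n1 : (n i).+1%:R != 0 :> R by rewrite pnatr_eq0.
have nf : (n i)`!%:R != 0 :> R by rewrite pnatr_eq0 -lt0n fact_gt0.
by field; rewrite nf nat1r n1. 
Qed.

Section poisson_family.
Local Open Scope ereal_scope.
Context {R : realType} {d} {T : measurableType d} (P : probability T R)
  (I : finType) (rho : I -> R) (X : T -> {ffun I -> nat}).
Hypothesis rho_ge0 : forall i, (0 <= rho i)%R.
Hypothesis mX : forall n, measurable (X @^-1` [set n]).
Hypothesis lawX : forall n, P (X @^-1` [set n]) = (poisson_weight rho n)%:E.

(** Valued in the extended reals, so that nonnegative functions are handled without proving
    integrability. *)
Definition mean (f : {ffun I -> nat} -> R) : \bar R := \int[P]_x (f (X x))%:E.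

Let measurable_mean (f : {ffun I -> nat} -> R) :
  measurable_fun [set: T] (fun x => (f (X x))%:E).
Proof. exact: (measurable_fun_discrete mX (EFin \o f)). Qed.

Lemma mean_esum (f : {ffun I -> nat} -> R) : (forall n, 0 <= f n)%R ->
  mean f = \esum_(n in [set: {ffun I -> nat}]) (f n * poisson_weight rho n)%:E.
Proof.
move=> f0; rewrite /mean (ge0_integral_partition mX)//; last first.
  by move=> x; rewrite lee_fin.
apply: eq_esum => n _; rewrite EFinM -lawX.
transitivity (\int[P]_(x in X @^-1` [set n]) cst (f n)%:E x).
  by apply: (eq_integral (cst (f n)%:E)) => x; rewrite inE /= => ->.
by rewrite integral_cst.
Qed.

Lemma meanZ k f : (0 <= k)%R -> (forall n, 0 <= f n)%R ->
  mean (fun n => k * f n)%R = k%:E * mean f.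
Proof.
move=> k0 f0; rewrite /mean -ge0_integralZl//.
- by move=> x _; rewrite lee_fin.
Qed.

Lemma meanD f g : (forall n, 0 <= f n)%R -> (forall n, 0 <= g n)%R ->
  mean (fun n => f n + g n)%R = mean f + mean g.
Proof.
move=> f0 g0; rewrite /mean -ge0_integralD//.
- by move=> x _; rewrite lee_fin.
- by move=> x _; rewrite lee_fin.
Qed.

Lemma mean_sum (J : finType) (p : pred J) (f : J -> {ffun I -> nat} -> R) :
  (forall j n, 0 <= f j n)%R ->
  mean (fun n => \sum_(j | p j) f j n)%R = \sum_(j | p j) mean (f j).
Proof.
move=> f0; rewrite -[RHS]big_filter /mean -ge0_integral_sum//; last first.
  by move=> j x _; rewrite lee_fin.
by apply: eq_integral => x _; rewrite sumEFin big_filter.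
Qed.

Lemma mean1 : mean (fun=> 1%R) = 1.
Proof. by rewrite /mean integral_cst// mul1e; exact: probability_setT. Qed.

Lemma mean_indicator (p : pred {ffun I -> nat}) :
  mean (fun n => (p n)%:R) = P [set x | p (X x)].
Proof.
have mp : measurable [set x | p (X x)].
  have := @measurable_fun_discrete _ _ _ _ mX _ bool p measurableT [set true].
  by rewrite setTI; exact.
rewrite -(setIT [set x | p (X x)]) -integral_indic//.
apply: eq_integral => x _; rewrite indicE; congr ((nat_of_bool _)%:R%:E).
by apply/idP/idP; rewrite inE.
Qed.

(** The sum over count vectors is re-indexed by the shift n -> n + e_i, and [poisson_weight_add_at]
    is applied to each term. *)
Lemma mean_mecke i f : (forall n, 0 <= f n)%R ->
  mean (fun n => (n i)%:R * f n)%R = (rho i)%:E * mean (fun n => f (add_at i n)).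
Proof.
move=> f0; rewrite mean_esum; last by move=> n; rewrite mulr_ge0.
have w0 n := poisson_weight_ge0 n rho_ge0.
rewrite (esumID (range (add_at i))); last first.
  by move=> n _; rewrite lee_fin !mulr_ge0.
(* A vector outside the range of the shift has [n i = 0], since otherwise removing one customer at
   [i] gives a preimage; its term is therefore 0. *)
rewrite [X in _ + X]esum1 ?adde0; last first.
  move=> n [_ /= ni]; case ni0 : (n i) => [|k]; first by rewrite !mul0r.
  exfalso; apply: ni; exists [ffun j => (n j - (j == i))%N] => //.
  apply/ffunP => j; rewrite !ffunE subnK//.
  by case: eqVneq => // ->; rewrite ni0.
rewrite setTI esum_image; last by move=> n m _ _; exact: add_at_inj.
rewrite -meanZ// mean_esum; last by move=> n; rewrite mulr_ge0.
apply: eq_esum => n _; congr EFin.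
by rewrite mulrAC poisson_weight_add_at mulrAC.
Qed.

End poisson_family.

(** * Moments of the customer counts of slices *)

Section slice_moments.
Local Open Scope ereal_scope.
Context {R : realType} {d} {T : measurableType d} (P : probability T R)
  (B V : finType) (rho : B -> V -> R) (X : T -> {ffun B * V -> nat}).
Hypothesis rho_ge0 : forall b w, (0 <= rho b w)%R.
Hypothesis mX : forall n, measurable (X @^-1` [set n]).
Hypothesis lawX : forall n,
  P (X @^-1` [set n]) = (poisson_weight (fun i => rho i.1 i.2) n)%:E.

Let total w (n : {ffun B * V -> nat}) := (\sum_b n (b, w))%N.

Hypothesis void_prob : forall w,
  P [set x | total w (X x) == 0%N] = (expR (- overall_load rho w))%:E.

Local Notation E := (mean P X).

Let eq_mean f g : f =1 g -> E f = E g.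
Proof. by move=> /funext ->. Qed.

Let mecke b w f : (forall n, 0 <= f n)%R ->
  E (fun n => (n (b, w))%:R * f n)%R =
  (rho b w)%:E * E (fun n => f (add_at (b, w) n)).
Proof. by move=> f0; rewrite (mean_mecke _ mX lawX)// => -[]. Qed.

Let total_add_at b v w n : total w (add_at (b, v) n) = (total w n + (v == w))%N.
Proof.
rewrite /total; under eq_bigr do rewrite ffunE xpair_eqE.
rewrite big_split/= [X in (_ + X)%N](_ : _ = (v == w) :> nat)//.
rewrite (bigD1 b)//= eqxx [w == v]eq_sym big1 ?addn0// => b' /negbTE -> //.
Qed.

Let q w : R := (1 - expR (- overall_load rho w))%R.

Let mean_nonempty w : E (fun n => (0 < total w n)%:R%R) = (q w)%:E.
Proof.
rewrite (mean_indicator _ mX (fun n => 0 < total w n)%N).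
rewrite (_ : [set x | _] = ~` [set x | total w (X x) == 0%N]); last first.
  by apply/seteqP; split => x /=; rewrite lt0n => /negP.
rewrite probability_setC ?void_prob//.
have := measurable_fun_discrete mX (fun n => total w n == 0%N) measurableT
  (Y := [set true]).
by rewrite setTI; exact.
Qed.

(** Two uses of the Mecke equation: E[N^2] = rho E[N + 1] = rho (rho + 1). *)
Lemma mean_count_sqr b v :
  E (fun n => (n (b, v))%:R * (n (b, v))%:R)%R = (rho b v * (rho b v + 1))%:E.
Proof.
rewrite mecke//.
(* The explicit factor 1 is the constant function to which the Mecke equation is applied the second
   time. *)
rewrite (eq_mean (g := fun n => ((n (b, v))%:R * 1 + 1)%R)); last first.
  by move=> n; rewrite ffunE eqxx natrD mulr1.
rewrite (meanD _ mX)// ?mecke//.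
by rewrite mean1 mule1 -EFinD -EFinM.
Qed.

(** Mecke at [(b, v)] turns N^v into N^v + 1 and leaves N^w alone, as [v != w]; expanding N^v over
    the stations, Mecke at each [(b', v)] then produces the overall load of [v]. *)
Let mean_count_total b v w : v != w ->
  E (fun n => (n (b, v))%:R * (total v n)%:R * (0 < total w n)%:R)%R =
  (rho b v * (overall_load rho v + 1) * q w)%:E.
Proof.
move=> vw; have {}vw : (v == w) = false by apply/negbTE.
under eq_mean do rewrite -mulrA.
rewrite mecke; last by move=> n; rewrite mulr_ge0.
rewrite -mulrA [in RHS]EFinM; congr (_ * _).
rewrite (eq_mean (g := fun n =>
    (\sum_b' (n (b', v))%:R * (0 < total w n)%:R + (0 < total w n)%:R)%R));
  last first.
  by move=> n; rewrite !total_add_at eqxx vw addn0 natrD mulrDl mul1r natr_sum mulr_suml.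
rewrite (meanD _ mX)//; last first.
  by move=> n; rewrite sumr_ge0// => b' _; rewrite mulr_ge0.
rewrite (mean_sum _ mX); last by move=> b' n; rewrite mulr_ge0.
rewrite mean_nonempty mulrDl mul1r [in RHS]EFinD; congr (_ + _).
rewrite /overall_load mulr_suml -sumEFin; apply: eq_bigr => b' _.
rewrite mecke// EFinM; congr (_ * _).
by rewrite -mean_nonempty; apply: eq_mean => n; rewrite total_add_at vw addn0.
Qed.

Hypothesis load_gt0 : forall w, (0 < overall_load rho w)%R.

(* The Mecke equation at (b, w) shows that the mean is proportional to
   [rho b w]; the constant is found by summing over b. *)
Lemma mean_count_share b v w : v != w ->
  E (fun n => (n (b, v))%:R * (total v n)%:R *
              ((n (b, w))%:R / (total w n)%:R))%R =
  (rho b v * (overall_load rho v + 1) *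
     (relative_load rho w b * (1 - expR (- overall_load rho w))))%:E.
Proof.
move=> vw; have wv : (w == v) = false by apply/negbTE; rewrite eq_sym.
pose f (n : {ffun B * V -> nat}) : R := ((n (b, v))%:R * (total v n)%:R)%R.
pose Z := E (fun n => f n / (total w n).+1%:R)%R.
have f0 n : (0 <= f n)%R by rewrite mulr_ge0.
(* The station [b] inside [f] stays fixed while [b'] varies. Adding a customer at [(b', w)] changes
   1/N^w into 1/(N^w + 1) and does not affect [f], so the factor [Z] is the same for all [b']. *)
have share b' : E (fun n => f n * ((n (b', w))%:R / (total w n)%:R))%R =
    (rho b' w)%:E * Z.
  under eq_mean do rewrite mulrCA.
  rewrite mecke; last by move=> n; rewrite divr_ge0.
  congr (_ * _); apply: eq_mean => n; rewrite /f !total_add_at eqxx wv addn0 addn1.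
  by rewrite ffunE xpair_eqE [v == w]eq_sym wv andbF addn0.
have sumZ : (overall_load rho w)%:E * Z =
    (rho b v * (overall_load rho v + 1) * q w)%:E.
  rewrite -(mean_count_total _ vw) /overall_load -sumEFin ge0_sume_distrl; last first.
    by move=> i _; rewrite lee_fin.
  under eq_bigr do rewrite -share.
  rewrite -(mean_sum _ mX); last by move=> b' n; rewrite mulr_ge0// divr_ge0.
  apply: eq_mean => n; rewrite -mulr_sumr -mulr_suml -natr_sum -/(total w n).
  (* The shares of a nonempty slice add up to 1, and those of an empty one to 0 by the convention
     [0^-1 = 0]; this is where the indicator of nonemptiness comes from. *)
  congr (_ * _)%R; have [->|t0] := posnP (total w n); first by rewrite mul0r.
  by rewrite divff// pnatr_eq0 -lt0n.
transitivity ((rho b w)%:E * Z); first exact: share.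
have -> : Z = ((overall_load rho w)^-1)%:E * ((overall_load rho w)%:E * Z).
  by rewrite muleA -EFinM mulVf ?mul1e// gt_eqF.
rewrite sumZ -!EFinM; congr EFin; rewrite /relative_load /q.
by field; rewrite gt_eqF.
Qed.

End slice_moments.

(** * Laws of the counts and peak rates in the model *)

Section model_laws.
Local Open Scope ereal_scope.
Context {R : realType} {B V : finType} {d : measure_display}
  {T : measurableType d} {Q : probability T R} {C : B -> V -> {RV Q >-> R}}.
Variable m : slicing_model C.

(** All counts are gathered in one variable with values in a countable type, whose fibres partition
    the sample space. *)
Definition counts (x : sample_space m) : {ffun B * V -> nat} :=
  [ffun p => Defs.count m p.1 p.2 x].

Let slot : eqType := (((B * V) + (B * V * nat))%type : eqType).

Let pmf b w k : R := ((load m b w) ^+ k / k`!%:R * expR (- load m b w))%R.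

Let prob_count b w k : prob m (Defs.count m b w @^-1` [set k]) = (pmf b w k)%:E.
Proof.
have := count_poisson m b w [set k]; rewrite /distribution /pushforward => ->.
rewrite /poisson_prob /pmf; case: ifPn => [r0|].
  rewrite esum_set1 /poisson_pmf r0//.
  by rewrite lee_fin mulr_ge0 ?expR_ge0// divr_ge0 ?exprn_ge0// ltW.
(* At load 0 the law is by definition the Dirac mass at 0, which [pmf] reproduces since
   [0 ^+ 0 = 1]. *)
rewrite -leNgt => r0; have -> : load m b w = 0%R.
  by apply/eqP; rewrite eq_le r0 load_ge0.
rewrite diracE oppr0 expR0 mulr1; case: k => [|k].
  by rewrite mem_set// expr0 fact0 divr1.
by rewrite memNset//= exprS !mul0r.
Qed.

Let event (n : {ffun B * V -> nat}) (i : slot) : set (sample_space m) :=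
  match i with
  | inl p => Defs.count m p.1 p.2 @^-1` [set n p]
  | inr _ => setT
  end.

Let event_generated n p : generated_system (Defs.count m) (peak m) (inl p) (event n (inl p)).
Proof. by case: p => b w; exists [set n (b, w)] => //; rewrite setTI. Qed.

Let bigsetIE (S : seq (B * V)) n :
  \big[setI/setT]_(p <- S) event n (inl p) =
  [set x | {in S, forall p, counts x p = n p}].
Proof.
apply/seteqP; split=> x.
  elim: S => [_ p//|p S IH]; rewrite big_cons => -[/= xp /IH/= xS] r.
  by rewrite inE => /predU1P[->|/xS//]; rewrite ffunE.
elim: S => [|p S IH] /= xS; first by rewrite big_nil.
rewrite big_cons; split; first by have := xS p (mem_head _ _); rewrite ffunE.
by apply: IH => r rS; apply: xS; rewrite inE rS orbT.
Qed.

(** The product rule for an arbitrary subfamily [S]: all pairs give the joint law, the pairs of a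
    single slice give the probability that it is empty. *)
Let prob_counts_seq (S : seq (B * V)) (n : {ffun B * V -> nat}) : uniq S ->
  prob m [set x | {in S, forall p, counts x p = n p}] =
  (\prod_(p <- S) pmf p.1 p.2 (n p))%:E.
Proof.
move=> uS; rewrite -bigsetIE.
have := @model_independent _ _ _ _ _ _ _ m [seq inl p | p <- S] (event n).
rewrite !big_map => ->; last 2 first.
- by rewrite map_inj_uniq// => p q [].
- by move=> _ /mapP[p _ ->]; exact: event_generated.
by elim/big_rec2: _ => //= p y _ _ ->; rewrite prob_count -EFinM.
Qed.

Lemma preimage_countsE (n : {ffun B * V -> nat}) :
  counts @^-1` [set n] = [set x | {in index_enum (B * V)%type, forall p, counts x p = n p}].
Proof.
apply/seteqP; split=> x /= xn; first by move=> p _; rewrite xn.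
by apply/ffunP => p; rewrite xn// mem_index_enum.
Qed.

Lemma measurable_counts (n : {ffun B * V -> nat}) : measurable (counts @^-1` [set n]).
Proof.
rewrite preimage_countsE -bigsetIE; apply: bigsetI_measurable => p _.
by rewrite -[X in measurable X]setTI; exact: measurable_funPT.
Qed.

Lemma prob_counts (n : {ffun B * V -> nat}) :
  prob m (counts @^-1` [set n]) = (poisson_weight (fun i => load m i.1 i.2) n)%:E.
Proof. by rewrite preimage_countsE prob_counts_seq// index_enum_uniq. Qed.

(** A slice is empty exactly when each of its counts is 0, and the factors e^(-rho_b) multiply to
    the exponential of minus the overall load. *)
Lemma prob_slice_empty w :
  prob m [set x | (\sum_b counts x (b, w))%N == 0%N] =
  (expR (- overall_load (load m) w))%:E.
Proof.
pose S := [seq (b, w) | b <- index_enum B].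
have -> : [set x | (\sum_b counts x (b, w))%N == 0%N] =
    [set x | {in S, forall p, counts x p = [ffun=> 0%N] p}].
  apply/seteqP; split=> x /=.
    rewrite sum_nat_eq0 => /forallP xw p /mapP[b _ ->].
    by rewrite [RHS]ffunE; apply/eqP; have := xw b.
  move=> xS; rewrite sum_nat_eq0; apply/forallP => b; apply/implyP => _.
  by rewrite xS ?ffunE//; apply: map_f; rewrite mem_index_enum.
rewrite prob_counts_seq; last by rewrite map_inj_uniq ?index_enum_uniq// => b b' [].
rewrite big_map /overall_load -sumrN expR_sum; congr EFin; apply: eq_bigr => b _.
by rewrite ffunE /pmf expr0 fact0 divr1 mul1r.
Qed.

(** Independence is mutual, so one peak-rate event can be put in front of the list of all count
    events before the product rule is applied. *)
Lemma peak_counts_independent b w k (n : {ffun B * V -> nat}) (S : set R) : measurable S ->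
  prob m (peak m b w k @^-1` S `&` counts @^-1` [set n]) =
  prob m (counts @^-1` [set n]) * prob m (peak m b w k @^-1` S).
Proof.
move=> mS; pose A i := if i is inr _ then peak m b w k @^-1` S else event n i.
have := @model_independent _ _ _ _ _ _ _ m
  (inr (b, w, k) :: [seq inl p | p <- index_enum (B * V)%type]) A.
rewrite !big_cons !big_map bigsetIE -preimage_countsE => ->.
- rewrite muleC; congr (_ * _); rewrite prob_counts /poisson_weight.
  by elim/big_rec2: _ => //= p y _ _ ->; rewrite prob_count -EFinM.
- rewrite cons_uniq map_inj_uniq ?index_enum_uniq ?andbT => [|p q []//].
  by apply/mapP => -[].
- move=> i; rewrite inE => /predU1P[->|/mapP[p _ ->]].
    by exists S => //; rewrite setTI.
  exact: event_generated.
Qed.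

Hypothesis C_mean : forall b w, 0 < mean_inverse_peak C b w < +oo.

(** The mean depends only on the law. Absolute values make the integrand nonnegative on the whole
    line, which the transfer between the two probability spaces requires. *)
Lemma mean_inverse_peakE b w k :
  \int[prob m]_x ((peak m b w k x)^-1)%:E = (delta C w b)%:E.
Proof.
have minv : measurable_fun [set: R] (fun y : R => `|y^-1|%:E).
  apply/measurable_EFinP; apply: measurableT_comp => //; exact: measurable_invr.
have distrE A : measurable A ->
    distribution (prob m) (peak m b w k) A = distribution Q (C b w) A.
  exact: peak_distribution.
(* Positivity is given pointwise for the peak rates; equality of laws carries it over to [C b w]
   almost surely. *)
have Q0 : Q (C b w @^-1` `]-oo, 0%R]) = 0.
  have := distrE `]-oo, 0%R]%classic (measurable_itv _).
  rewrite /distribution /pushforward => <-.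
  rewrite (_ : _ @^-1` _ = set0) ?measure0//; apply/seteqP; split => x //=.
  by rewrite in_itv/= leNgt peak_gt0.
transitivity (\int[Q]_x `|(C b w x)^-1|%:E).
  transitivity (\int[prob m]_x `|(peak m b w k x)^-1|%:E).
    by apply: eq_integral => x _; rewrite ger0_norm// invr_ge0 ltW// peak_gt0.
  rewrite -[LHS](ge0_integral_distribution (peak m b w k) minv)//.
  rewrite -[RHS](ge0_integral_distribution (C b w) minv)//.
  by apply: eq_measure_integral => A mA _; exact: distrE.
rewrite /delta fineK; last first.
  by have /andP[c0 cy] := C_mean b w; rewrite ge0_fin_numE// ltW.
rewrite /mean_inverse_peak unlock; apply: ae_eq_integral => //.
- exact: (measurableT_comp minv).
- apply/measurable_EFinP; apply: measurableT_comp => //; exact: measurable_invr.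
- exists (C b w @^-1` `]-oo, 0%R]); split => //.
    by rewrite -[X in measurable X]setTI; exact: measurable_funPT.
  move=> x /= neq; rewrite in_itv/= leNgt; apply/negP => c0; apply: neq => _.
  by rewrite ger0_norm// invr_ge0 ltW.
Qed.

Lemma integral_peak_on_counts b w k (n : {ffun B * V -> nat}) :
  \int[prob m]_(x in counts @^-1` [set n]) ((peak m b w k x)^-1)%:E =
  (delta C w b * poisson_weight (fun i => load m i.1 i.2) n)%:E.
Proof.
have minv : measurable_fun [set: R] (fun y : R => `|y^-1|%:E).
  apply/measurable_EFinP; apply: measurableT_comp => //; exact: measurable_invr.
have absE D : \int[prob m]_(x in D) ((peak m b w k x)^-1)%:E =
    \int[prob m]_(x in D) `|(peak m b w k x)^-1|%:E.
  by apply: eq_integral => x _; rewrite ger0_norm// invr_ge0 ltW// peak_gt0.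
rewrite absE.
rewrite (ge0_integral_indep (c := peak m b w k) (measurable_counts n) _ minv)//.
  by rewrite -absE mean_inverse_peakE prob_counts muleC -EFinM.
by move=> S mS; rewrite peak_counts_independent.
Qed.

(** A Wald-type identity: on the event that the counts equal [n], the number of terms and the
    weights [G b n] are constants, and each inverse peak rate integrates to [delta] times the
    probability of the event. *)
Lemma expectation_customers (v : V) (G : B -> {ffun B * V -> nat} -> R) :
  (forall b n, 0 <= G b n)%R ->
  'E_(prob m)[(fun x => \sum_b \sum_(k < Defs.count m b v x)
     G b (counts x) * (peak m b v k x)^-1)%R] =
  \sum_b (delta C v b)%:E *
    mean (prob m) counts (fun n => (n (b, v))%:R * G b n)%R.
Proof.
move=> G0; rewrite unlock.
have inv0 b k x : (0 <= (peak m b v k x)^-1)%R by rewrite invr_ge0 ltW// peak_gt0.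
have minv b k : measurable_fun [set: sample_space m] (fun x => (peak m b v k x)^-1)%R.
  by apply: measurableT_comp => //; exact: measurable_invr.
(* [F n] freezes the counts at [n], so it is a finite sum with deterministic bounds and hence
   measurable. *)
pose F (n : {ffun B * V -> nat}) x : R :=
  (\sum_b \sum_(k < n (b, v)) G b n * (peak m b v k x)^-1)%R.
have mF n : measurable_fun [set: sample_space m] (F n).
  apply: measurable_sum => b; apply: measurable_sum => k.
  by apply: measurable_funM.
rewrite (eq_integral (fun x => (F (counts x) x)%:E)); last first.
  move=> x _ /=; congr EFin; rewrite /F; apply: eq_bigr => b _.
  by rewrite ffunE.
have F0 n x : (0 <= F n x)%R.
  by apply: sumr_ge0 => b _; apply: sumr_ge0 => k _; rewrite mulr_ge0.
rewrite (ge0_integral_partition measurable_counts); last 2 first.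
- apply/measurable_EFinP; apply: (measurable_fun_partition measurable_counts) => n.
  apply: (@eq_measurable_fun _ _ _ _ _ (F n)); last exact: measurable_funTS.
  by move=> x; rewrite inE /= => ->.
- by move=> x; rewrite lee_fin.
pose w n := poisson_weight (fun i => load m i.1 i.2) n.
have w0 n : (0 <= w n)%R by apply: poisson_weight_ge0 => i; exact: load_ge0.
have d0 b : (0 <= delta C v b)%R.
  by apply: fine_ge0; have /andP[/ltW] := C_mean b v.
transitivity (\esum_(n in [set: {ffun B * V -> nat}])
    \sum_b (delta C v b * ((n (b, v))%:R * G b n) * w n)%:E).
  apply: eq_esum => n _.
  transitivity (\int[prob m]_(x in counts @^-1` [set n])
      \sum_b \sum_(k < n (b, v)) (G b n)%:E * ((peak m b v k x)^-1)%:E).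
    apply: eq_integral => x; rewrite inE /= => ->.
    rewrite /F -sumEFin; apply: eq_bigr => b _.
    by rewrite -sumEFin; apply: eq_bigr.
  have mn := measurable_counts n.
  have mpeak b k : measurable_fun (counts @^-1` [set n]) (fun x => ((peak m b v k x)^-1)%:E).
    by apply: measurable_funTS; exact/measurable_EFinP.
  have mterm b k : measurable_fun (counts @^-1` [set n])
      (fun x => (G b n)%:E * ((peak m b v k x)^-1)%:E).
    exact: measurable_funeM.
  have term0 b k x : 0 <= (G b n)%:E * ((peak m b v k x)^-1)%:E.
    by rewrite mule_ge0// lee_fin.
  rewrite ge0_integral_sum//; last 2 first.
  - by move=> b; apply: emeasurable_sum.
  - by move=> b x _; apply: sume_ge0.
  apply: eq_bigr => b _; rewrite ge0_integral_sum//.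
  (* All customers at [b] contribute the same amount, so the inner sum is their number times one
     term. *)
  rewrite (eq_bigr (fun=> (G b n * (delta C v b * w n))%:E)) => [|k _].
    rewrite sumEFin sumr_const card_ord -mulr_natl; congr EFin.
    by ring.
  rewrite ge0_integralZl ?lee_fin//; last by move=> x _; rewrite lee_fin.
  by rewrite integral_peak_on_counts -EFinM.
rewrite esum_sum; last by move=> n b _ _; rewrite lee_fin !mulr_ge0.
apply: eq_bigr => b _.
rewrite -(meanZ _ measurable_counts)//; last by move=> n; rewrite mulr_ge0.
rewrite (mean_esum measurable_counts prob_counts)// => n.
by rewrite !mulr_ge0.
Qed.

End model_laws.

Arguments counts {R B V d T Q C} m x.
Arguments measurable_counts {R B V d T Q C} m n.
Arguments prob_counts {R B V d T Q C} m n.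
Arguments prob_slice_empty {R B V d T Q C} m w.

(** * Algebra, monotonicity and limits of the gain formula *)

Lemma cvg_finsum (R : numFieldType) (I : Type) (F : set_system I) (FF : Filter F)
    (J : finType) (p : pred J) (f : J -> I -> R) (l : J -> R) :
  (forall j, p j -> f j i @[i --> F] --> l j) ->
  \sum_(j | p j) f j i @[i --> F] --> \sum_(j | p j) l j.
Proof.
move=> fl; elim: (index_enum J) => [|j S IH].
  by rewrite big_nil; under eq_cvg do rewrite big_nil; exact: cvg_cst.
rewrite big_cons; under eq_cvg do rewrite big_cons.
by case: ifPn => // pj; apply: cvgD => //; exact: fl.
Qed.

(** The share of the other slices in the weighted product of [g_tilde'] with [rt v]; it does not
    involve the load of [v]. *)
Definition interference (R : realType) (B V : finType) (s r : V -> R)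
    (rt : V -> B -> R) (dl : B -> R) (v : V) : R :=
  \sum_b (\sum_(w | w != v) s w * (1 - expR (- r w)) * rt w b) * dl b * rt v b.

Section gain_formula.
Context {R : realType} {B V : finType} (s : V -> R) (rt dl : V -> B -> R) (v : V).

Lemma inner_diag_g_tilde' (r : V -> R) :
  inner_diag (dl v) (g_tilde' s r rt) (rt v) =
  s v * (1 - expR (- r v)) * sqnorm_diag (dl v) (rt v) + interference s r rt (dl v) v.
Proof.
rewrite /sqnorm_diag /inner_diag /interference mulr_sumr -big_split/=.
by apply: eq_bigr => b _; rewrite /g_tilde' (bigD1 v)//= !mulrDl !mulrA.
Qed.

(** The term of [v] in [g_tilde'] cancels the exponentials of [v]: -(1 - (r+1)e) + (r+1)(1 - e) = r
    with e = e^(-r). The load of [v] then enters only through affine functions. *)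
Lemma gain_formulaE (r : V -> R) :
  gain_formula s r rt dl v =
  (r v * sqnorm_diag (dl v) (rt v) + inner (dl v) (rt v)) /
  (s v * (r v * sqnorm_diag (dl v) (rt v) + inner (dl v) (rt v)) +
   (r v + 1) * interference s r rt (dl v) v).
Proof. by rewrite /gain_formula inner_diag_g_tilde'; congr (_ / _); ring. Qed.

Lemma light_gainE (r : V -> R) :
  light_gain s r rt dl v =
  inner (dl v) (rt v) / (s v * inner (dl v) (rt v) + interference s r rt (dl v) v).
Proof.
rewrite /light_gain inner_diag_g_tilde' eqxx oppr0 expR0 subrr mulr0 mul0r add0r.
congr (_ / (_ + _)); apply: eq_bigr => b _; congr (_ * _ * _).
by apply: eq_bigr => w /negbTE ->.
Qed.

Lemma eq_interference (r r' : V -> R) :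
  (forall w, w != v -> r' w = r w) ->
  interference s r' rt (dl v) v = interference s r rt (dl v) v.
Proof.
move=> rr; apply: eq_bigr => b _; congr (_ * _ * _).
by apply: eq_bigr => w wv; rewrite rr.
Qed.

Hypothesis s_gt0 : forall w, 0 < s w.
Hypothesis dl_gt0 : forall w b, 0 < dl w b.
Hypothesis rt_ge0 : forall w b, 0 <= rt w b.
Hypothesis rt_sum : forall w, \sum_b rt w b = 1.

Lemma relative_le1 w b : rt w b <= 1.
Proof. by rewrite -(rt_sum w) (bigD1 b)//= lerDl sumr_ge0. Qed.

Lemma sqnorm_diag_gt0 : 0 < sqnorm_diag (dl v) (rt v).
Proof.
have [b /= b0] : exists b, true && (0 < rt v b).
  by apply: psumr_neq0P => //; rewrite rt_sum; exact/eqP/oner_neq0.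
rewrite /sqnorm_diag /inner_diag (bigD1 b)//=.
by rewrite ltr_wpDr ?sumr_ge0 ?mulr_gt0// => b' _; rewrite !mulr_ge0// ltW.
Qed.

(** Relative loads lie in [0, 1], so each square is at most the load itself. *)
Lemma sqnorm_diag_le_inner : sqnorm_diag (dl v) (rt v) <= inner (dl v) (rt v).
Proof.
apply: ler_sum => b _; rewrite [rt v b * _]mulrC ler_piMr ?relative_le1//.
by rewrite mulr_ge0// ltW.
Qed.

Lemma inner_gt0 : 0 < inner (dl v) (rt v).
Proof. exact: lt_le_trans sqnorm_diag_gt0 sqnorm_diag_le_inner. Qed.

Lemma interference_ge0 (r : V -> R) : (forall w, 0 < r w) ->
  0 <= interference s r rt (dl v) v.
Proof.
move=> r0; apply: sumr_ge0 => b _; rewrite !mulr_ge0 ?(ltW (dl_gt0 _ _))//.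
apply: sumr_ge0 => w _; rewrite !mulr_ge0 ?(ltW (s_gt0 _))// subr_ge0.
by rewrite -expR0 ler_expR oppr_le0 ltW.
Qed.

(** With c = <delta, rt>, the interference is at most [K] c, where [K] < 1 - s_v, so the denominator
    is below s_v c + (1 - s_v) c = c. *)
Lemma light_gain_gt1 (r : V -> R) : (forall w, 0 < r w) -> \sum_w s w = 1 ->
  (1 < #|V|)%N -> 1 < light_gain s r rt dl v.
Proof.
move=> r0 s1 V1; rewrite light_gainE.
have i0 := inner_gt0; have h0 := interference_ge0 r0.
have den0 : 0 < s v * inner (dl v) (rt v) + interference s r rt (dl v) v.
  by rewrite ltr_pwDl// mulr_gt0.
rewrite ltr_pdivlMr// mul1r.
pose K := \sum_(w | w != v) s w * (1 - expR (- r w)).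
have hK : interference s r rt (dl v) v <= K * inner (dl v) (rt v).
  rewrite /interference /inner mulr_sumr; apply: ler_sum => b _; rewrite -mulrA.
  rewrite ler_wpM2r ?mulr_ge0 ?(ltW (dl_gt0 _ _))//.
  apply: ler_sum => w _; rewrite ler_piMr ?relative_le1// mulr_ge0 ?(ltW (s_gt0 _))//.
  by rewrite subr_ge0 -expR0 ler_expR oppr_le0 ltW.
(* Strictness comes from a second slice [w], for which 1 - e^(-r_w) < 1; with a single slice the
   gain would equal 1. *)
have K1 : K < 1 - s v.
  rewrite -s1 (bigD1 v)//= addrAC subrr add0r.
  have [w wv] : exists w, w != v.
    have : (0 < #|predC1 v|)%N.
      by rewrite -(ltn_add2l 1) addn0 -[X in (_ < X + _)%N](card1 v) cardC.
    by move=> /card_gt0P[w]; rewrite inE => wv; exists w.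
  rewrite /K (bigD1 w)//= [ltRHS](bigD1 w)//= ltr_leD//.
    by rewrite gtr_pMr// gtrBl expR_gt0.
  by apply: ler_sum => w' _; rewrite ger_pMr// gerBl expR_ge0.
have := ltr_pM2r i0 K (1 - s v); rewrite K1 mulrBl mul1r => Ki.
by rewrite -ltrBrDl (le_lt_trans hK).
Qed.

Lemma gain_formula_nonincreasing (r r' : V -> R) : (forall w, 0 < r w) ->
  (forall w, w != v -> r' w = r w) -> r v <= r' v ->
  gain_formula s r' rt dl v <= gain_formula s r rt dl v.
Proof.
move=> r0 rr rv; rewrite !gain_formulaE (eq_interference rr).
have := sqnorm_diag_gt0; have := sqnorm_diag_le_inner; have := interference_ge0 r0.
set a := sqnorm_diag _ _; set c := inner _ _; set h := interference _ _ _ _ _.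
move=> h0 ac a0; have r0v := r0 v; have s0 := s_gt0 v.
(* Stating positivity for every x above [r v] covers both loads to be compared. *)
have N0 x : r v <= x -> 0 < x * a + c.
  by move=> rx; rewrite addr_gt0 ?mulr_gt0// (lt_le_trans _ rx, lt_le_trans a0).
have D0 x : r v <= x -> 0 < s v * (x * a + c) + (x + 1) * h.
  move=> rx; rewrite ltr_pwDl ?mulr_gt0 ?N0// mulr_ge0// addr_ge0//.
  by rewrite (le_trans _ rx)// ltW.
rewrite ler_pdivrMr ?D0// mulrAC ler_pdivlMr ?D0//.
(* After cross-multiplication the terms with [s v] cancel, and the difference factors into three
   nonnegative terms. *)
rewrite -subr_ge0 (_ : _ - _ = h * ((r' v - r v) * (c - a))); last by ring.
by rewrite mulr_ge0// mulr_ge0// subr_ge0.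
Qed.

(** Along the filter the interference is constant, so the gain is a rational function of the load of
    [v] whose denominator has a positive limit. *)
Lemma cvg_gain_light (I : Type) (F : set_system I) (FF : Filter F)
    (r : V -> R) (r' : I -> V -> R) : (forall w, 0 < r w) ->
  (forall i w, w != v -> r' i w = r w) -> r' i v @[i --> F] --> (0 : R) ->
  gain_formula s (r' i) rt dl v @[i --> F] --> light_gain s r rt dl v.
Proof.
move=> r0 rr rv0; rewrite light_gainE.
under eq_cvg do rewrite gain_formulaE (eq_interference (rr _)).
set a := sqnorm_diag _ _; set c := inner _ _; set h := interference _ _ _ _ _.
have num : r' i v * a + c @[i --> F] --> c.
  have : r' i v * a + c @[i --> F] --> 0 * a + c.
    by apply: cvgD; [apply: cvgM => //; exact: cvg_cst|exact: cvg_cst].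
  by rewrite mul0r add0r.
apply: cvgM => //; apply: cvgV.
  by rewrite gt_eqF// ltr_pwDl ?interference_ge0// mulr_gt0// inner_gt0.
apply: cvgD; first by apply: cvgM => //; exact: cvg_cst.
have : (r' i v + 1) * h @[i --> F] --> (0 + 1) * h.
  by apply: cvgM; [apply: cvgD => //; exact: cvg_cst|exact: cvg_cst].
by rewrite add0r mul1r.
Qed.

(** Numerator and denominator are divided by the load of [v]; then its inverse and all exponentials
    tend to 0. *)
Lemma cvg_gain_heavy (I : Type) (F : set_system I) (FF : Filter F)
    (r : I -> V -> R) : (forall i w, 0 < r i w) ->
  (forall w, r i w @[i --> F] --> +oo) ->
  gain_formula s (r i) rt dl v @[i --> F] --> heavy_gain s rt dl v.
Proof.
move=> r0 roo; rewrite /heavy_gain.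
set a := sqnorm_diag _ _; set c := inner (dl v) (rt v).
(* The limit of the interference, obtained by dropping every exponential. *)
pose hoo := \sum_b (\sum_(w | w != v) s w * rt w b) * dl v b * rt v b.
have -> : inner_diag (dl v) (g_tilde s rt) (rt v) = s v * a + hoo.
  rewrite /a /hoo /sqnorm_diag /inner_diag mulr_sumr -big_split/=.
  by apply: eq_bigr => b _; rewrite /g_tilde (bigD1 v)//= !mulrDl !mulrA.
have e0 w : expR (- r i w) @[i --> F] --> (0 : R).
  exact: (cvg_comp _ _ (roo w) (@cvgr_expR R)).
have hh : interference s (r i) rt (dl v) v @[i --> F] --> hoo.
  apply: cvg_finsum => b _; apply: cvgM; last exact: cvg_cst.
  apply: cvgM; last exact: cvg_cst.
  apply: cvg_finsum => w _; apply: cvgM; last exact: cvg_cst.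
  have : s w * (1 - expR (- r i w)) @[i --> F] --> s w * (1 - 0).
    by apply: cvgM; [exact: cvg_cst|apply: cvgB => //; exact: cvg_cst].
  by rewrite subr0 mulr1.
have u0 : (r i v)^-1 @[i --> F] --> (0 : R).
  by apply/(gtr0_cvgV0 _).2; [exact: nearW|exact: roo].
have -> : (fun i => gain_formula s (r i) rt dl v) =
    (fun i => (a + (r i v)^-1 * c) /
      (s v * (a + (r i v)^-1 * c) + (1 + (r i v)^-1) * interference s (r i) rt (dl v) v)).
  apply/funext => i; rewrite gain_formulaE -/a -/c.
  have ri : r i v != 0 by rewrite gt_eqF.
  set h := interference _ _ _ _ _.
  have -> : a + (r i v)^-1 * c = (r i v)^-1 * (r i v * a + c) by field.
  have -> : s v * ((r i v)^-1 * (r i v * a + c)) + (1 + (r i v)^-1) * h =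
      (r i v)^-1 * (s v * (r i v * a + c) + (r i v + 1) * h) by field.
  by rewrite invfM mulrACA divff ?mul1r// invr_eq0.
have num : a + (r i v)^-1 * c @[i --> F] --> a.
  have : a + (r i v)^-1 * c @[i --> F] --> a + 0 * c.
    by apply: cvgD; [exact: cvg_cst|apply: cvgM => //; exact: cvg_cst].
  by rewrite mul0r addr0.
apply: cvgM => //; apply: cvgV.
  rewrite gt_eqF// ltr_pwDl ?mulr_gt0 ?sqnorm_diag_gt0//.
  apply: sumr_ge0 => b _; rewrite !mulr_ge0 ?(ltW (dl_gt0 _ _))//.
  by apply: sumr_ge0 => w _; rewrite mulr_ge0 ?(ltW (s_gt0 _)).
apply: cvgD; first by apply: cvgM => //; exact: cvg_cst.
have : (1 + (r i v)^-1) * interference s (r i) rt (dl v) v @[i --> F] -->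
    (1 + 0) * hoo.
  by apply: cvgM => //; apply: cvgD => //; exact: cvg_cst.
by rewrite addr0 mul1r.
Qed.

End gain_formula.

(** * Mean delays under the two policies and their ratio *)

Section delays.
Local Open Scope ereal_scope.
Context {R : realType} {B V : finType} {s : V -> R} {d : measure_display}
  {T : measurableType d} {Q : probability T R} {C : B -> V -> {RV Q >-> R}}.
Hypothesis s_gt0 : forall w, (0 < s w)%R.
Hypothesis C_mean : forall b w, 0 < mean_inverse_peak C b w < +oo.
Variables (m : slicing_model C) (v : V).

Let rho := load m.
Let r := overall_load rho.
Let rt := relative_load rho.
Let dl := delta C.
Let count_at (n : {ffun B * V -> nat}) (b : B) (w : V) := n (b, w).

Let rho_relE b w : rho b w = (r w * rt w b)%R.
Proof. by rewrite /rt /relative_load mulrCA divff ?mulr1// gt_eqF// overall_load_gt0. Qed.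

(** Both policies grant rates proportional to the peak rate, so an inverse rate is a function of the
    counts times the inverse peak rate. *)
Lemma mean_BTD_linear (rate : (B -> V -> nat) -> B -> V -> R -> R)
    (G : B -> {ffun B * V -> nat} -> R) :
  (forall b n, 0 <= G b n)%R ->
  (forall n b c, (rate (count_at n) b v c)^-1 = G b n * c^-1)%R ->
  mean_BTD rate m v = (r v)^-1%:E *
    \sum_b (dl v b)%:E * mean (prob m) (counts m)
                          (fun n => (n (b, v))%:R * G b n)%R.
Proof.
move=> G0 rateG; rewrite /mean_BTD -expectation_customers//.
congr (_ * 'E_ _ [ _ ]); apply/funext => x.
apply: eq_bigr => b _; apply: eq_bigr => k _; rewrite -rateG; congr (rate _ _ _ _)^-1%R.
by apply/funext => b'; apply/funext => w; rewrite /count_at ffunE.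
Qed.

(** Here [G] is N_b / s_v, so only the second moment of a Poisson count is involved. *)
Lemma mean_BTD_SS :
  mean_BTD (rate_SS s) m v =
  ((s v)^-1 * (r v * sqnorm_diag (dl v) (rt v) + inner (dl v) (rt v)))%:E.
Proof.
have r0 : r v != 0%R by rewrite gt_eqF// overall_load_gt0.
rewrite (@mean_BTD_linear _ (fun b n => (s v)^-1 * (n (b, v))%:R)%R); last 2 first.
- by move=> b n; rewrite mulr_ge0// invr_ge0 ltW.
- by move=> n b c; rewrite /rate_SS invfM invf_div [(_ / s v)%R]mulrC.
have -> : (\sum_b (dl v b)%:E * mean (prob m) (counts m)
    (fun n => (n (b, v))%:R * ((s v)^-1 * (n (b, v))%:R))%R) =
    \sum_b ((s v)^-1 * (dl v b * (rho b v * (rho b v + 1))))%:E.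
  apply: eq_bigr => b _.
  have -> : (fun n : {ffun B * V -> nat} => (n (b, v))%:R * ((s v)^-1 * (n (b, v))%:R))%R =
      (fun n => (s v)^-1 * ((n (b, v))%:R * (n (b, v))%:R))%R.
    by apply/funext => n; rewrite mulrCA.
  rewrite (meanZ _ (measurable_counts m)); last 2 first.
  - by rewrite invr_ge0 ltW.
  - by move=> n; rewrite mulr_ge0.
  rewrite (@mean_count_sqr _ _ _ _ _ _ rho _ (load_ge0 m)
    (measurable_counts m) (prob_counts m)).
  by rewrite -!EFinM mulrCA.
rewrite sumEFin -EFinM; congr EFin.
rewrite -mulr_sumr mulrCA; congr (_ * _)%R.
rewrite /sqnorm_diag /inner_diag /inner !mulr_sumr -big_split/=.
apply: eq_bigr => b _; rewrite rho_relE.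
by field.
Qed.

(** Here [G] is N^v / s_v times the sum of s_w N_b^w / N^w. The term of [v] reduces to N_b^v,
    leaving a second moment as under static slicing; the other terms are given by
    [mean_count_share]. *)
Lemma mean_BTD_SCPF :
  mean_BTD (rate_SCPF s) m v =
  ((s v)^-1 * (s v * (r v * sqnorm_diag (dl v) (rt v) + inner (dl v) (rt v)) +
               (r v + 1) * interference s r rt (dl v) v))%:E.
Proof.
have r0 : r v != 0%R by rewrite gt_eqF// overall_load_gt0.
have s0 : s v != 0%R by rewrite gt_eqF.
pose total w (n : {ffun B * V -> nat}) := (\sum_b n (b, w))%N.
pose share b w (n : {ffun B * V -> nat}) : R := ((n (b, w))%:R / (total w n)%:R)%R.
have share0 b w n : (0 <= share b w n)%R by rewrite divr_ge0.
rewrite (@mean_BTD_linear _ (fun b n =>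
  (s v)^-1 * (total v n)%:R * \sum_w s w * share b w n)%R); last 2 first.
- move=> b n; rewrite !mulr_ge0 ?invr_ge0 ?(ltW (s_gt0 _))//.
  by apply: sumr_ge0 => w _; rewrite mulr_ge0// ltW.
- move=> n b c; rewrite /rate_SCPF invfM !invf_div; congr (_ * _)%R.
  rewrite mulrC [(_ / s v)%R]mulrC; congr (_ * _)%R.
  rewrite big_mkcond/=; apply: eq_bigr => w _.
  rewrite -[slice_count _ w]/(total w n) -[count_at n b w]/(n (b, w)) /share.
  (* The rate sums over nonempty slices only; empty ones may be included, as their share is 0 by
     [0^-1 = 0]. *)
  have [->|_] := posnP (total w n); last by rewrite mulrA [(_ * s w)%R]mulrC.
  by rewrite invr0 !mulr0.
have splitE b : (fun n : {ffun B * V -> nat} =>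
      (n (b, v))%:R * ((s v)^-1 * (total v n)%:R * \sum_w s w * share b w n))%R =
    (fun n => (n (b, v))%:R * (n (b, v))%:R + (s v)^-1 *
      \sum_(w | w != v) s w * ((n (b, v))%:R * (total v n)%:R * share b w n))%R.
  apply/funext => n; rewrite (bigD1 v)//= !mulrDr; congr (_ + _)%R.
    (* N^v cancels only when it is nonzero; if it vanishes, so does N_b^v, and both sides are 0. *)
    have [t0|t0] := posnP (total v n).
      move/eqP: (t0); rewrite sum_nat_eq0 => /forallP/(_ b)/implyP/(_ isT)/eqP ->.
      by rewrite !mul0r.
    have t1 : ((total v n)%:R != 0 :> R)%R by rewrite pnatr_eq0 -lt0n.
    by rewrite /share; field; rewrite t1 s0.
  rewrite !mulr_sumr; apply: eq_bigr => w _.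
  by ring.
have meanE b : mean (prob m) (counts m) (fun n =>
      (n (b, v))%:R * ((s v)^-1 * (total v n)%:R * \sum_w s w * share b w n))%R =
    (rho b v * (rho b v + 1) + (s v)^-1 * \sum_(w | w != v)
      s w * (rho b v * (r v + 1) * (rt w b * (1 - expR (- r w)))))%:E.
  have term0 w (n : {ffun B * V -> nat}) :
      (0 <= s w * ((n (b, v))%:R * (total v n)%:R * share b w n))%R.
    by rewrite mulr_ge0 ?(ltW (s_gt0 _))// mulr_ge0// mulr_ge0.
  rewrite splitE (meanD _ (measurable_counts m)); last 2 first.
  - by move=> n; rewrite mulr_ge0.
  - by move=> n; rewrite mulr_ge0 ?invr_ge0 ?(ltW (s_gt0 _))// sumr_ge0.
  rewrite (@mean_count_sqr _ _ _ _ _ _ rho _ (load_ge0 m)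
    (measurable_counts m) (prob_counts m)) EFinD; congr (_ + _).
  rewrite (meanZ _ (measurable_counts m)); last 2 first.
  - by rewrite invr_ge0 ltW.
  - by move=> n; rewrite sumr_ge0.
  rewrite EFinM; congr (_ * _); rewrite (mean_sum _ (measurable_counts m))//.
  rewrite -sumEFin; apply: eq_bigr => w wv.
  rewrite (meanZ _ (measurable_counts m)); last 2 first.
  - by rewrite ltW.
  - by move=> n; rewrite mulr_ge0// mulr_ge0.
  rewrite EFinM; congr (_ * _).
  apply: (@mean_count_share _ _ _ _ _ _ rho _ (load_ge0 m)
    (measurable_counts m) (prob_counts m)).
  - exact: prob_slice_empty.
  - exact: overall_load_gt0.
  - by rewrite eq_sym.
under eq_bigr do rewrite meanE -EFinM.
rewrite sumEFin -EFinM; congr EFin.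
rewrite /sqnorm_diag /inner_diag /inner /interference !(mulr_sumr, mulrDr) -!big_split/=.
apply: eq_bigr => b _; rewrite rho_relE.
(* Factors independent of [w] are pulled out, so that the remaining sum is an atom for [field]. *)
rewrite (eq_bigr (fun w => r v * rt v b * (r v + 1) *
    (s w * (1 - expR (- r w)) * rt w b))%R) => [|w _]; last by ring.
rewrite -mulr_sumr; set S := (\sum_(w | _) _)%R.
by field; rewrite r0 s0.
Qed.

(** Both delays are finite and the denominator is nonzero, so the extended quotient is a real one,
    in which the common factor 1/s_v cancels. *)
Lemma BTD_gainE : BTD_gain s m v = (gain_formula s r rt dl v)%:E.
Proof.
have dl_gt0 w b : (0 < dl w b)%R by exact: fine_gt0.
have rt_ge0 w b : (0 <= rt w b)%R.
  by rewrite divr_ge0 ?load_ge0// ltW// overall_load_gt0.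
have rt_sum w : (\sum_b rt w b = 1)%R.
  by rewrite -mulr_suml divff// gt_eqF// overall_load_gt0.
have r_gt0 w : (0 < r w)%R by exact: overall_load_gt0.
have a0 := sqnorm_diag_gt0 v dl_gt0 rt_ge0 rt_sum.
have i0 := inner_gt0 v dl_gt0 rt_ge0 rt_sum.
have h0 := interference_ge0 v s_gt0 dl_gt0 rt_ge0 r_gt0.
have r0 := r_gt0 v; have s0 := s_gt0 v.
have n0 : (0 < r v * sqnorm_diag (dl v) (rt v) + inner (dl v) (rt v))%R.
  by rewrite addr_gt0// mulr_gt0.
have d0 : (0 < s v * (r v * sqnorm_diag (dl v) (rt v) + inner (dl v) (rt v)) +
    (r v + 1) * interference s r rt (dl v) v)%R.
  by rewrite ltr_pwDl ?mulr_gt0// mulr_ge0// addr_ge0// ltW.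
rewrite /BTD_gain mean_BTD_SS mean_BTD_SCPF inver mulf_eq0 invr_eq0.
rewrite (gt_eqF s0) (gt_eqF d0)/= -EFinM; congr EFin.
rewrite gain_formulaE invfM invrK mulrACA mulVf ?mul1r// gt_eqF//.
Qed.

End delays.

Unset Implicit Arguments.

Theorem corollary1 (R : realType) (B V : finType) (s : V -> R)
    (s_gt0 : forall w, 0 < s w) (s_sum : \sum_w s w = 1)
    (d : measure_display) (T : measurableType d) (Q : probability T R)
    (C : B -> V -> {RV Q >-> R})
    (C_mean : forall b w, (0 < mean_inverse_peak C b w < +oo)%E)
    (m : slicing_model C) (v : V) :
  let r := overall_load (load m) in
  let rt := relative_load (load m) in
  let dl := delta C in
  [/\ BTD_gain s m v = (gain_formula s r rt dl v)%:E,
      (forall (I : Type) (F : set_system I) (FF : Filter F)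
          (m' : I -> slicing_model C),
        (forall i, relative_load (load (m' i)) = rt) ->
        (forall i w, w != v -> overall_load (load (m' i)) w = r w) ->
        overall_load (load (m' i)) v @[i --> F] --> (0 : R) ->
        BTD_gain s (m' i) v @[i --> F] --> (light_gain s r rt dl v)%:E) /\
      ((1 < #|V|)%N -> 1 < light_gain s r rt dl v),
      (forall m' : slicing_model C,
        relative_load (load m') = rt ->
        (forall w, w != v -> overall_load (load m') w = r w) ->
        r v <= overall_load (load m') v ->
        (BTD_gain s m' v <= BTD_gain s m v)%E)
    & (forall (I : Type) (F : set_system I) (FF : Filter F)
          (m' : I -> slicing_model C),
        (forall i, relative_load (load (m' i)) = rt) ->
        (forall w, overall_load (load (m' i)) w @[i --> F] --> +oo) ->
        BTD_gain s (m' i) v @[i --> F] --> (heavy_gain s rt dl v)%:E) ].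
Proof.
move=> r rt dl.
have dl_gt0 w b : 0 < dl w b by apply: fine_gt0; exact: C_mean.
have r_gt0 (m' : slicing_model C) w : 0 < overall_load (load m') w.
  exact: overall_load_gt0.
have rt_ge0 w b : 0 <= rt w b by rewrite divr_ge0 ?load_ge0// ltW// r_gt0.
have rt_sum w : \sum_b rt w b = 1.
  by rewrite -mulr_suml; apply: divff; rewrite gt_eqF// r_gt0.
have gainE m' := BTD_gainE s_gt0 C_mean m' v.
split.
- exact: gainE.
- split=> [I F FF m' rtE rE r0|]; last first.
    exact: (light_gain_gt1 v s_gt0 dl_gt0 rt_ge0 rt_sum (r_gt0 m) s_sum).
  (* The exact formula holds for each model along the filter with the same relative loads, which
     reduces the claim to a limit of real functions. *)
  under eq_cvg do rewrite gainE rtE.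
  apply: cvg_EFin; first exact: nearW.
  exact: (cvg_gain_light s_gt0 dl_gt0 rt_ge0 rt_sum FF (r_gt0 m) rE r0).
- move=> m' rtE rE rv; rewrite !gainE rtE lee_fin.
  apply: gain_formula_nonincreasing => //; exact: r_gt0.
- move=> I F FF m' rtE roo.
  under eq_cvg do rewrite gainE rtE.
  apply: cvg_EFin; first exact: nearW.
  exact: (cvg_gain_heavy s_gt0 dl_gt0 rt_ge0 rt_sum FF (fun i => r_gt0 (m' i)) roo).
Qed.
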